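(* Let $d\ge2$, let $\{v_n\}_{n\ge1}$ and $\{w_m\}_{m\ge1}$ be $\frac12$-uniformly distributed sequences in $[0,1]^d$, and fix $0<t<d$. Then for every $\epsilon>0$ there exists $C_\epsilon>0$ such that for all integers $N\ge1$, $$\#\{(n,m)\in\{1,\dots,N\}^2: v_n\cdot w_m=t\}\le C_\epsilon N^{\frac32+\epsilon}.$$
   Context: $x\cdot y$ is the usual Euclidean dot product of points of $[0,1]^d\subset\mathbb{R}^d$. For $\gamma\in(0,\frac12]$, a sequence of points $\{v_n\}_{n\ge1}$ in $[0,1]^d$ is $\gamma$-uniformly distributed if for every $\epsilon>0$ there is a constant $C_\epsilon$ such that for every $k\in\mathbb{Z}^d\setminus\{0\}$ and every integer $N\ge 1$, $$\left|\frac1N\sum_{n=1}^N e^{2\pi i k\cdot v_n}\right|\le C_\epsilon|k|^\epsilon N^{-\gamma}.$$ The constant $C_\epsilon$ in the claim may depend on $d$, $t$ and the two sequences, but not on $N$. *)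

(* Defs.v *)
From HB Require Import structures.
From mathcomp Require Import all_boot all_order all_algebra.
From mathcomp Require Import all_classical all_reals all_analysis.
From mathcomp Require Import complex.

Set Implicit Arguments.
Unset Strict Implicit.
Unset Printing Implicit Defensive.

Import Order.TTheory GRing.Theory Num.Theory.

Local Open Scope ring_scope.
Local Open Scope complex_scope.

Definition dot (R : realType) (d : nat) (x y : 'rV[R]_d) : R :=
  \sum_(i < d) x ord0 i * y ord0 i.

(* The Euclidean norm; the library's norm on 'rV[R]_d is the sup norm. *)
Definition enorm (R : realType) (d : nat) (x : 'rV[R]_d) : R :=
  Num.sqrt (dot x x).

Definition in_cube (R : realType) (d : nat) (x : 'rV[R]_d) : Prop :=
  forall i : 'I_d, 0 <= x ord0 i <= 1.

(* e^(i x) for real x *)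
Definition expi (R : realType) (x : R) : R[i] := cos x +i* sin x.

(* Sequences are indexed from 1: the value at 0 is never used. *)
Definition seq_in_cube (R : realType) (d : nat) (v : nat -> 'rV[R]_d) : Prop :=
  forall n : nat, (1 <= n)%N -> in_cube (v n).

(* [map_mx intr k] is the integer vector k seen in R^d.  The inequality is
   between complex numbers: it compares the (real) modulus with a real. *)
Definition uniformly_distributed (R : realType) (d : nat) (gamma : R)
    (v : nat -> 'rV[R]_d) : Prop :=
  forall eps : R, 0 < eps -> exists C : R,
  forall (k : 'rV[int]_d) (N : nat), k != 0 -> (1 <= N)%N ->
    `| N%:R^-1 * \sum_(1 <= n < N.+1)
                    expi (2 * pi * dot (map_mx intr k) (v n)) |
    <= (C * enorm (map_mx intr k) `^ eps * N%:R `^ (- gamma))%:C.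

Definition dot_count (R : realType) (d : nat) (v w : nat -> 'rV[R]_d) (t : R)
    (N : nat) : nat :=
  #|[set p : 'I_N * 'I_N | dot (v p.1.+1) (w p.2.+1) == t]|.

(* Main.v *)
Require Import Defs.
From mathcomp Require Import all_boot all_order all_algebra.
From mathcomp Require Import all_classical all_reals all_analysis.
From mathcomp Require Import complex ring lra.

Set Implicit Arguments.
Unset Strict Implicit.
Unset Printing Implicit Defensive.

Import Order.TTheory GRing.Theory Num.Theory.
Local Open Scope ring_scope.

(** It suffices to bound, for each single m, the number of n <= N with
    v_n . w_m = t by a constant times N^(1/2 + eps), uniformly in w_m; summing
    over the N values of m gives the exponent 3/2 + eps.

    Fix w = w_m.  If v_n . w = t has a solution in the cube, then some coordinate
    of w is at least t / d, so for a fixed integer q >= d / t the vector y = q w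
    has a coordinate >= 1, and the equation reads x . y = tau with tau = q t.
    Round the multiples of y to integer vectors: k_j = floor(j y).  A coordinate
    of y being >= 1, the k_j are distinct.  Writing e(z) for exp(2 pi i z), a
    point x of the hyperplane satisfies

      e(k_j . x - j tau) = e(- frac(j y) . x),

    so if j is restricted to a set T on which the vectors frac(j y) lie in a
    common cube of side 1 / (8 d + 1), these numbers have almost the same
    argument for all j in T, and |sum_(j in T) e(k_j . x - j tau)|^2 >= |T|^2 / 2.
    By the pigeonhole principle such a T with |T| >= N exists among the
    j < (8 d + 1)^d N ([exists_cell], [gram_incident]).

    Sum the square over x = v_1, ..., v_N and expand it ([hyperplane_count]).
    Each of the |T| diagonal terms contributes N; each off-diagonal term is a
    twisted exponential sum of v at the frequency k_i - k_j, which is nonzero and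
    of size O(N), hence it is O(N^(1/2 + eps)) ([twisted_weyl_sum]).  If A points
    lie on the hyperplane, then

      A |T|^2 / 2 <= |T| N + O(|T|^2 N^(1/2 + eps)),

    and |T| >= N turns this into A = O(N^(1/2 + eps)).

    The squared modulus |sum_j e(h_j)|^2 appears in its real form, the double sum
    of the cosines of the phase differences. *)

(** * Cosine sums, pigeonhole, rounding *)

Lemma cos_ge_half (R : realType) (x : R) : `|x| <= pi / 4 -> 1 / 2 <= cos x.
Proof.
move=> hx; have pi0 := pi_gt0 R.
have := hx; rewrite ler_norml => /andP[h1 h2].
have c0 : 0 <= cos x by apply: cos_ge0_pihalf; apply/andP; split; lra.
have : 0 <= cos (x + x) by apply: cos_ge0_pihalf; apply/andP; split; lra.
rewrite cosD -!expr2 sin2cos2 => c2; nra.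
Qed.

(** The double sum is the squared modulus of the sum of the unit complex numbers
    of arguments [h i]. *)
Lemma cos_gram_ge0 (R : realType) (I : finType) (A : {set I}) (h : I -> R) :
  0 <= \sum_(i in A) \sum_(j in A) cos (h i - h j).
Proof.
suff -> : \sum_(i in A) \sum_(j in A) cos (h i - h j) =
    (\sum_(i in A) cos (h i)) ^+ 2 + (\sum_(i in A) sin (h i)) ^+ 2.
  by rewrite addr_ge0 ?sqr_ge0.
rewrite !expr2 !big_distrlr -big_split; apply: eq_bigr => i _ /=.
by rewrite -big_split; apply: eq_bigr => j _ /=; rewrite cosB.
Qed.

Lemma pigeonhole_fiber (T U : finType) (f : T -> U) (n : nat) :
  (0 < #|U|)%N -> (#|U| * n <= #|T|)%N ->
  exists u : U, (n <= #|[set x | f x == u]|)%N.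
Proof.
case: n => [|n] U0 hT; first by case/card_gt0P: U0 => u _; exists u.
apply/existsP; apply: contraLR hT; rewrite negb_exists -ltnNge => /forallP h.
have -> : #|T| = (\sum_(u : U) #|[set x | f x == u]|)%N.
  rewrite -sum1_card (partition_big f predT) //=.
  by apply: eq_bigr => u _; rewrite -sum1_card; apply: eq_bigl => x; rewrite inE.
apply: (@leq_ltn_trans (#|U| * n)%N); last by rewrite ltn_pmul2l.
rewrite -sum_nat_const; apply: leq_sum => u _.
by have := h u; rewrite -ltnNge ltnS.
Qed.

Lemma floor_separated (R : realType) (y : R) (m n : nat) :
  1 <= y -> (m < n)%N -> Num.floor (m%:R * y) < Num.floor (n%:R * y).
Proof.
move=> y1 mn; rewrite -lezD1 floor_ge_int intrD.
have := floor_le (m%:R * y); have : m.+1%:R <= n%:R :> R by rewrite ler_nat.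
rewrite -natr1; set a := m%:R; set b := n%:R; nra.
Qed.

Lemma truncn_eq_close (R : realType) (a b : R) :
  0 <= a -> 0 <= b -> Num.truncn a = Num.truncn b -> `|a - b| <= 1.
Proof.
move=> a0 b0 e; have := truncn_itv a0; have := truncn_itv b0.
rewrite -e -natr1 ler_norml => /andP[? ?] /andP[? ?].
by apply/andP; split; lra.
Qed.

(** * Dot product and Euclidean norm *)

Section Dot.
Context (R : realType) (d : nat).
Implicit Types x y : 'rV[R]_d.

Lemma dotBl x y z : dot (x - y) z = dot x z - dot y z.
Proof.
rewrite /dot -sumrB; apply: eq_bigr => i _.
by rewrite !mxE mulrBl.
Qed.

Lemma dotZl (a : R) x y : dot (a *: x) y = a * dot x y.
Proof. by rewrite /dot mulr_sumr; apply: eq_bigr => i _; rewrite mxE mulrA. Qed.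

Lemma dotC x y : dot x y = dot y x.
Proof. by apply: eq_bigr => i _; rewrite mulrC. Qed.

Lemma enorm_le (B : R) x : 0 <= B -> (forall i, `|x ord0 i| <= B) ->
  enorm x <= d%:R * B.
Proof.
move=> B0 hx; rewrite /enorm -(ger0_norm (mulr_ge0 (ler0n R d) B0)) -sqrtr_sqr.
apply: ler_wsqrtr; apply: (@le_trans _ _ (\sum_(i < d) B ^+ 2)).
  apply: ler_sum => i _; rewrite -expr2 -real_normK ?num_real //.
  by rewrite lerXn2r ?nnegrE // (le_trans _ (hx i)).
rewrite sumr_const card_ord -[B ^+ 2 *+ d]mulr_natl exprMn ler_wpM2r ?sqr_ge0 //.
by rewrite -natrX ler_nat; case: (d) => // m; rewrite leq_pmulr.
Qed.

Lemma norm_dot_cube (B : R) x y : (forall i, `|x ord0 i| <= B) -> in_cube y ->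
  `|dot x y| <= d%:R * B.
Proof.
move=> hx hy; apply: le_trans (ler_norm_sum _ _ _) _.
apply: (@le_trans _ _ (\sum_(i < d) B)); last by rewrite sumr_const card_ord mulr_natl.
apply: ler_sum => i _; have /andP[y0 y1] := hy i.
rewrite normrM (ger0_norm y0) -[B]mulr1.
by apply: ler_pM.
Qed.

End Dot.

(** * Exponential sums along a uniformly distributed sequence *)

Lemma norm_expi (R : realType) (x : R) : `|expi x| = 1.
Proof. by rewrite normc_def /= cos2Dsin2 sqrtr1. Qed.


(** The twist by [phi] multiplies the exponential sum by a number of modulus 1 and
    passing to cosines takes the real part, so neither increases the modulus. *)
Lemma twisted_weyl_sum (R : realType) (d : nat) (eps : R) (v : nat -> 'rV[R]_d) :
  uniformly_distributed (1 / 2) v -> 0 < eps ->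
  exists2 K : R, 0 <= K & forall (k : 'rV[int]_d) (N : nat) (phi : R),
    k != 0 -> (1 <= N)%N ->
    \sum_(n < N) cos (2 * pi * dot (map_mx intr k) (v n.+1) - phi)
    <= K * enorm (map_mx intr k) `^ eps * N%:R `^ (1 / 2).
Proof.
move=> ud eps0; have [C hC] := ud eps eps0.
(* The hypothesis does not fix the sign of C, hence the absolute value. *)
exists `|C| => // k N phi k0 N1; have := hC k N k0 N1.
rewrite big_add1 /= big_mkord.
set S := \sum_(n < N) _; set E := enorm _ `^ eps => hS.
have N0 : 0 < N%:R :> R by rewrite ltr0n.
have -> : \sum_(n < N) cos (2 * pi * dot (map_mx intr k) (v n.+1) - phi) =
   complex.Re (expi (- phi) * S).
  rewrite /S mulr_sumr raddf_sum /=; apply: eq_bigr => n _.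
  by rewrite cosN sinN cosB; ring.
rewrite -lecR; apply: (@le_trans _ _ `|S|).
  apply: le_trans (_ : (`|complex.Re (expi (- phi) * S)|)%:C%C <= _).
    by rewrite lecR ler_norm.
  by apply: le_trans (normc_ge_Re _) _; rewrite normrM norm_expi mul1r.
have {}hS : `|S| <= (N%:R * (C * E * N%:R `^ (- (1 / 2))))%:C%C.
  move: hS; rewrite normrM normfV normr_nat.
  by rewrite ler_pdivrMl ?ltr0n // -(rmorph_nat (real_complex R)) -rmorphM.
apply: le_trans hS _; rewrite lecR.
have -> : N%:R * (C * E * N%:R `^ (- (1 / 2))) = C * E * N%:R `^ (1 / 2).
  rewrite mulrCA -{1}[N%:R]powRr1 ?ler0n // -powRD; last first.
    by apply/implyP; rewrite (gt_eqF N0).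
  by congr (_ * _ `^ _); lra.
by rewrite !ler_wpM2r ?powR_ge0 // ler_norm.
Qed.

(** * Rounded multiples of a vector and their phases *)

Section Cells.
Context (R : realType) (d : nat).
Implicit Types x y : 'rV[R]_d.

Definition floor_row x : 'rV[int]_d := map_mx Num.floor x.

Definition frac_row x : 'rV[R]_d := x - map_mx intr (floor_row x).

Lemma frac_row_itv x i : 0 <= frac_row x ord0 i < 1.
Proof.
rewrite !mxE; have := floor_itv (x ord0 i); rewrite intrD => /andP[h1 h2].
by apply/andP; split; lra.
Qed.

(** Cutting the unit cube into [M.+1 ^ d] cells, some cell receives the fractional
    parts of at least [n] of the first [M.+1 ^ d * n] vectors. *)
Lemma exists_cell (M n : nat) (x : nat -> 'rV[R]_d) :
  exists2 T : {set 'I_(M.+1 ^ d * n)}, (n <= #|T|)%N &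
    forall i j, i \in T -> j \in T -> forall a,
      `|(frac_row (x i) - frac_row (x j)) ord0 a| <= M.+1%:R^-1.
Proof.
pose f (i : 'I_(M.+1 ^ d * n)) : {ffun 'I_d -> 'I_M.+1} :=
  [ffun a => inord (Num.truncn (M.+1%:R * frac_row (x i) ord0 a))].
have cU : #|{ffun 'I_d -> 'I_M.+1}| = (M.+1 ^ d)%N by rewrite card_ffun !card_ord.
have [||u hu] := @pigeonhole_fiber _ _ f n.
- by rewrite cU expn_gt0.
- by rewrite cU card_ord.
exists [set i | f i == u] => // i j; rewrite !inE => /eqP fi /eqP fj a.
have M0 : 0 < M.+1%:R :> R by rewrite ltr0n.
have trunc_lt z : (Num.truncn (M.+1%:R * frac_row z ord0 a) < M.+1)%N.
  have /andP[z0 z1] := frac_row_itv z a.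
  by rewrite truncn_lt_nat ?mulr_ge0 ?ler0n // gtr_pMr.
have e : Num.truncn (M.+1%:R * frac_row (x i) ord0 a) =
         Num.truncn (M.+1%:R * frac_row (x j) ord0 a).
  have : f i a = f j a by rewrite fi fj.
  by rewrite !ffunE => /(congr1 val) /=; rewrite !inordK.
have /andP[i0 _] := frac_row_itv (x i) a.
have /andP[j0 _] := frac_row_itv (x j) a.
have -> : (frac_row (x i) - frac_row (x j)) ord0 a =
    frac_row (x i) ord0 a - frac_row (x j) ord0 a.
  by rewrite [LHS]mxE [X in _ + X]mxE.
have := truncn_eq_close (mulr_ge0 (ltW M0) i0) (mulr_ge0 (ltW M0) j0) e.
by rewrite -mulrBr normrM (ger0_norm (ltW M0)) -ler_pdivlMl // mulr1.
Qed.

(** The argument of the j-th term e(k_j . x - j tau) of the sum; the correction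
    by [j%:R * tau] is the value of [dot (j%:R *: y)] on the hyperplane
    [dot y x = tau], where it leaves only the effect of rounding. *)
Definition phase y (tau : R) (j : nat) x : R :=
  2 * pi * (dot (map_mx intr (floor_row (j%:R *: y))) x - j%:R * tau).

Lemma phaseB y tau i j x :
  phase y tau i x - phase y tau j x =
  2 * pi * dot (map_mx intr (floor_row (i%:R *: y) - floor_row (j%:R *: y))) x
  - 2 * pi * ((i%:R - j%:R) * tau).
Proof. by rewrite map_mxB dotBl /phase; ring. Qed.

(** On the hyperplane the large part [j *: y] of the frequency cancels, and only
    the rounding error is left. *)
Lemma phase_incident y x i : phase y (dot y x) i x =
  - (2 * pi * dot (frac_row (i%:R *: y)) x).
Proof. by rewrite /phase /frac_row dotBl dotZl; ring. Qed.

(** At a point of the hyperplane lying in the cube, two phases differ by at most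
    2 pi d / (8 d + 1) <= pi / 4, so every cosine is at least 1 / 2. *)
Lemma gram_incident (I : finType) (T : {set I}) (s : I -> nat) y x :
  (0 < d)%N -> in_cube x ->
  (forall i j, i \in T -> j \in T -> forall a,
      `|(frac_row ((s i)%:R *: y) - frac_row ((s j)%:R *: y)) ord0 a|
      <= (8 * d).+1%:R^-1) ->
  #|T|%:R ^+ 2 / 2 <=
  \sum_(i in T) \sum_(j in T)
    cos (phase y (dot y x) (s i) x - phase y (dot y x) (s j) x).
Proof.
move=> d0 hx close; have pi0 := pi_gt0 R.
have -> : #|T|%:R ^+ 2 / 2 = \sum_(i in T) \sum_(j in T) (1 / 2 : R).
  by rewrite !sumr_const -mulrnA -[RHS]mulr_natl natrM; ring.
apply: ler_sum => i iT; apply: ler_sum => j jT.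
rewrite !phase_incident; apply: cos_ge_half.
have := norm_dot_cube (close i j iT jT) hx; rewrite dotBl.
set u := dot _ _; set w := dot _ _ => h.
have -> : - (2 * pi * u) - - (2 * pi * w) = - (2 * pi) * (u - w) by ring.
rewrite normrM normrN (ger0_norm (_ : 0 <= 2 * pi)); last by lra.
suff : `|u - w| <= 1 / 8 by nra.
apply: le_trans h _; rewrite ler_pdivrMr ?ltr0n //.
by rewrite -[(8 * d).+1%:R]natr1 natrM; lra.
Qed.

(** Consecutive multiples of a real number at least 1 have distinct integer parts;
    this makes every off-diagonal frequency nonzero. *)
Lemma floor_row_neq y i j : (exists a, 1 <= y ord0 a) -> i != j ->
  floor_row (i%:R *: y) - floor_row (j%:R *: y) != 0.
Proof.
case=> a ya; rewrite subr_eq0; apply: contra_neqN => /eqP/rowP/(_ a).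
rewrite !mxE; case: (ltngtP i j) => // ij.
  by have /lt_eqF := floor_separated ya ij => /eqP.
by have /gt_eqF := floor_separated ya ij => /eqP.
Qed.

Lemma enorm_floor_row (q L i j : nat) y :
  (forall a, 0 <= y ord0 a <= q%:R) -> (i < L)%N -> (j < L)%N ->
  enorm (map_mx intr (floor_row (i%:R *: y) - floor_row (j%:R *: y)) : 'rV[R]_d)
  <= (d * q * L)%:R.
Proof.
move=> hy iL jL; rewrite -mulnA natrM; apply: enorm_le; first exact: ler0n.
move=> a; rewrite !mxE intrB; have /andP[y0 y1] := hy a.
have bnd k : (k < L)%N -> 0 <= ((Num.floor (k%:R * y ord0 a))%:~R : R) <= (q * L)%:R.
  move=> kL; rewrite ler0z floor_ge0 mulr_ge0 ?ler0n //=.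
  apply: le_trans (floor_le _) _; rewrite mulnC natrM.
  by apply: ler_pM; rewrite ?ler0n // ler_nat ltnW.
have /andP[? ?] := bnd _ iL; have /andP[? ?] := bnd _ jL.
by rewrite ler_norml; apply/andP; split; lra.
Qed.

End Cells.

(** * Points of the sequence on a hyperplane *)

(** The second moment argument: the square of the sum over [T] is at least
    [#|T| ^ 2 / 2] at each incident point and nonnegative elsewhere, while its sum
    over all [N] points is controlled by equidistribution. The constant depends on
    [y] only through the bound [q] on its entries, which gives uniformity over
    the hyperplanes. *)
Lemma hyperplane_count (R : realType) (d q : nat) (eps : R) (v : nat -> 'rV[R]_d) :
  (0 < d)%N -> seq_in_cube v -> uniformly_distributed (1 / 2) v -> 0 < eps ->
  exists2 C : R, 0 < C & forall (y : 'rV[R]_d) (tau : R) (N : nat),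
    (forall a, 0 <= y ord0 a <= q%:R) -> (exists a, 1 <= y ord0 a) ->
    (1 <= N)%N ->
    #|[set n : 'I_N | dot y (v n.+1) == tau]|%:R <= C * N%:R `^ (1 / 2 + eps).
Proof.
move=> d0 vc ud eps0; have [K K0 hK] := twisted_weyl_sum ud eps0.
pose m := ((8 * d).+1 ^ d)%N; pose B : R := (d * q * m)%:R `^ eps.
have KB0 : 0 <= K * B by rewrite mulr_ge0 ?powR_ge0.
exists (2 * (1 + K * B)); first lra.
move=> y tau N hy y1 N1.
have [T cT close] := exists_cell (8 * d) N (fun j => j%:R *: y).
set A := #|_|; pose P := N%:R `^ (1 / 2 + eps) : R.
pose g n := \sum_(i in T) \sum_(j in T)
  cos (phase y tau i (v n.+1) - phase y tau j (v n.+1)).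
have P1 : 1 <= P by rewrite -(powRr0 N%:R) ler_powR ?ler1n //; lra.
have lower : A%:R * (#|T|%:R ^+ 2 / 2) <= \sum_(n < N) g n.
  rewrite (bigID (fun n : 'I_N => dot y (v n.+1) == tau)) /=.
  rewrite -[leLHS]addr0; apply: lerD; last first.
    by apply: sumr_ge0 => n _; apply: cos_gram_ge0.
  rewrite /A mulr_natl -sumr_const big_mkcond [leRHS]big_mkcond /=.
  apply: ler_sum => n _; rewrite inE /g; case: eqP => // <-.
  by apply: gram_incident => //; apply: vc.
have upper : \sum_(n < N) g n <= #|T|%:R ^+ 2 * (1 + K * B * P).
  rewrite exchange_big /=.
  have -> : #|T|%:R ^+ 2 * (1 + K * B * P) =
      \sum_(i in T) (#|T|%:R + \sum_(j in T) K * B * P).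
    by rewrite !sumr_const -[RHS]mulr_natl -(mulr_natl (K * B * P)); ring.
  apply: ler_sum => i iT; rewrite exchange_big /= (bigD1 i) //=.
  (* The diagonal j = i contributes at most N <= #|T|; the other pairs have a
     nonzero frequency. *)
  rewrite [in leRHS](bigD1 i) //= addrA.
  apply: lerD; last apply: ler_sum => j /andP[jT ij].
    apply: (@le_trans _ _ N%:R).
      apply: (@le_trans _ _ (\sum_(n < N) (1 : R))); last by rewrite sumr_const card_ord.
      by apply: ler_sum => n _; apply: cos_le1.
    by rewrite ler_wpDr ?ler_nat // mulr_ge0 // powR_ge0.
  under eq_bigr do rewrite phaseB.
  apply: le_trans (hK _ _ _ (floor_row_neq y1 _) N1) _.
    by rewrite eq_sym.
  rewrite /P -!mulrA; apply: ler_wpM2l => //.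
  have N0 : N%:R != 0 :> R by rewrite pnatr_eq0 -lt0n.
  rewrite [1 / 2 + eps]addrC powRD ?N0 ?implybT // !mulrA; apply: ler_wpM2r; first exact: powR_ge0.
  rewrite -powRM ?ler0n //; apply: ge0_ler_powR.
  - exact: ltW.
  - by rewrite nnegrE sqrtr_ge0.
  - by rewrite nnegrE mulr_ge0 ?ler0n.
  by rewrite -natrM -mulnA; apply: enorm_floor_row.
have T0 : 0 < #|T|%:R ^+ 2 :> R.
  by rewrite exprn_gt0 // ltr0n (leq_trans N1).
have : A%:R * (#|T|%:R ^+ 2 / 2) <= #|T|%:R ^+ 2 * (1 + K * B * P).
  exact: le_trans lower upper.
rewrite mulrCA ler_pM2l // ler_pdivrMr //.
rewrite -/P; nra.
Qed.

Unset Implicit Arguments.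

(** * Incidences between the two sequences *)

Theorem corollary1p5 (R : realType) (d : nat) (v w : nat -> 'rV[R]_d) (t : R) :
  (2 <= d)%N ->
  seq_in_cube v -> uniformly_distributed (1 / 2) v ->
  seq_in_cube w -> uniformly_distributed (1 / 2) w ->
  0 < t < d%:R ->
  forall eps : R, 0 < eps ->
  exists C : R, 0 < C /\
    forall N : nat, (1 <= N)%N ->
      (dot_count v w t N)%:R <= C * N%:R `^ (3 / 2 + eps).
Proof.
move=> d2 vc vud wc _ /andP[t0 _] eps eps0.
have d0 : (0 < d)%N by exact: leq_trans d2.
have dR : 0 < d%:R :> R by rewrite ltr0n.
(* q w has a coordinate >= 1 as soon as some point of the cube satisfies
   x . w = t, because then the largest coordinate of w is at least t / d. *)
pose q := (Num.truncn (d%:R / t)).+1.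
have qt : d%:R <= q%:R * t by rewrite -ler_pdivrMr // ltW // truncnS_gt.
have q0 : 0 < q%:R :> R by rewrite ltr0n.
have [C C0 hC] := hyperplane_count q d0 vc vud eps0.
exists C; split=> // N N1.
have fiber (m : 'I_N) :
  #|[set n : 'I_N | dot (v n.+1) (w m.+1) == t]|%:R <= C * N%:R `^ (1 / 2 + eps).
  case: (pselect (exists a, 1 <= (q%:R *: w m.+1) ord0 a)) => [big|small].
    have := hC (q%:R *: w m.+1) (q%:R * t) N _ big N1.
    have -> : [set n : 'I_N | dot (q%:R *: w m.+1) (v n.+1) == q%:R * t] =
              [set n : 'I_N | dot (v n.+1) (w m.+1) == t].
      by apply/setP => n; rewrite !inE dotZl dotC (inj_eq (mulfI (lt0r_neq0 q0))).
    apply=> a; have /andP[w0 w1] := wc m.+1 isT a.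
    by rewrite mxE mulr_ge0 ?ler0n //= ler_piMr.
  have -> : [set n : 'I_N | dot (v n.+1) (w m.+1) == t] = finset.set0.
    apply/setP => n; rewrite !inE; apply/negbTE/eqP => vw.
    have : q%:R * dot (v n.+1) (w m.+1) < \sum_(a < d) 1.
      rewrite dotC -dotZl /dot; apply: ltr_sum => [|a _].
        by apply/hasP; exists (Ordinal d0); rewrite ?mem_index_enum.
      have /andP[v0 v1] := vc n.+1 isT a.
      have /andP[w0 w1] := wc m.+1 isT a.
      have wa : (q%:R *: w m.+1) ord0 a < 1.
        by rewrite ltNge; apply/negP => h; apply: small; exists a.
      apply: le_lt_trans wa; rewrite ler_piMr // mxE mulr_ge0 ?ler0n //.
    by rewrite vw sumr_const card_ord ltNge qt.
  by rewrite cards0 mulr_ge0 ?powR_ge0 // ltW.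
have -> : (dot_count v w t N)%:R =
    \sum_(m < N) #|[set n : 'I_N | dot (v n.+1) (w m.+1) == t]|%:R :> R.
  rewrite -natr_sum; congr _%:R.
  transitivity (\sum_(m < N) \sum_(n < N | dot (v n.+1) (w m.+1) == t) 1)%N.
    rewrite (exchange_big_dep predT) //= pair_big_dep /= /dot_count -sum1_card.
    by apply: eq_bigl => p; rewrite inE.
  by apply: eq_bigr => m _; rewrite -sum1_card; apply: eq_bigl => n; rewrite inE.
apply: le_trans (ler_sum _ (fun m _ => fiber m)) _.
rewrite sumr_const card_ord -[leLHS]mulr_natl mulrCA; apply: ler_wpM2l; first exact: ltW.
rewrite -{1}[N%:R]powRr1 ?ler0n // -powRD; last first.
  by rewrite pnatr_eq0 -lt0n N1 implybT.
by rewrite (_ : 1 + (1 / 2 + eps) = 3 / 2 + eps) //; lra.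
Qed.
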